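(* Let $R=(R,+)$ be an upper bound additive monoid and let $U$ be an almost subtractive submonoid of $R$. (a) Every submonoid of $U$ is also almost subtractive in $R$. (b) If $(U_\lambda \mid \lambda\in\Lambda)$ is a nonempty chain (with respect to inclusion) of almost subtractive submonoids of $R$, then $\bigcup_{\lambda\in\Lambda}U_\lambda$ is an almost subtractive submonoid of $R$.
   Context: Additive monoids are abelian with identity $0$. Write $x\le_R y$ if $x+d=y$ for some $d\in R$; $R$ is upper bound if $\le_R$ is antisymmetric. A submonoid $U$ of $R$ is almost subtractive in $R$ if for all $u,\tilde u\in U$ and $z,z'\in R$ with $u+z=u+z'=\tilde u$ one has $z=z'$. *)

(* Defs.v *)
From mathcomp Require Import all_boot all_algebra.
From mathcomp Require Import boolp classical_sets.

Set Implicit Arguments.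
Unset Strict Implicit.
Unset Printing Implicit Defensive.

Import GRing.Theory.
Local Open Scope classical_set_scope.
Local Open Scope ring_scope.

Definition le_monoid (R : nmodType) (x y : R) : Prop := exists d : R, x + d = y.

Definition upper_bound (R : nmodType) : Prop :=
  forall x y : R, le_monoid x y -> le_monoid y x -> x = y.

(* [mem U] turns the Prop-valued subset [U] into a collective predicate via
   classical decidability. *)
Definition submonoid (R : nmodType) (U : set R) : Prop := GRing.nmod_closed (mem U).

Definition almost_subtractive (R : nmodType) (U : set R) : Prop :=
  submonoid U /\
  forall (u u' z z' : R), U u -> U u' -> u + z = u' -> u + z' = u' -> z = z'.

Definition set_chain (T L : Type) (U : L -> set T) : Prop :=
  forall l m : L, U l `<=` U m \/ U m `<=` U l.

(* Main.v *)
Require Import Defs.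
From mathcomp Require Import all_boot all_algebra.
From mathcomp Require Import boolp classical_sets.

Set Implicit Arguments.
Unset Strict Implicit.
Unset Printing Implicit Defensive.

Import GRing.Theory.
Local Open Scope classical_set_scope.
Local Open Scope ring_scope.

(** Cancellation is a universal condition on pairs [u], [u'] of the submonoid, with [z], [z']
    ranging over all of [R], so it passes to smaller submonoids. In a union of a chain, closure
    under addition and cancellation each involve just two members of the union; by
    [set_chain_directed] these lie in a common [W k], where the property is already known. *)

(** Trades the boolean predicate [mem U] for Prop-valued membership, so that elements of a union can
    be destructed into an index and a proof. *)
Lemma submonoidE (R : nmodType) (U : set R) :
  submonoid U <-> U 0 /\ (forall x y, U x -> U y -> U (x + y)).
Proof.
split=> [[U0 UD]|[U0 UD]].
  split=> [|x y Ux Uy]; first exact: set_mem.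
  by apply: set_mem; apply: UD; apply: mem_set.
split; first exact: mem_set.
by move=> x y /set_mem Ux /set_mem Uy; apply: mem_set; apply: UD.
Qed.

(** The larger of the two sets serves as the common bound. *)
Lemma set_chain_directed (T L : Type) (W : L -> set T) (l m : L) :
  set_chain W -> exists k, W l `<=` W k /\ W m `<=` W k.
Proof. by move=> /(_ l m)[lm|ml]; [exists m|exists l]; split. Qed.

Theorem proposition1p3 (R : nmodType) (hR : upper_bound R)
    (U : set R) (hU : almost_subtractive U) :
  (forall V : set R, submonoid V -> V `<=` U -> almost_subtractive V) /\
  (forall (L : Type) (W : L -> set R),
     inhabited L -> set_chain W ->
     (forall l : L, almost_subtractive (W l)) ->
     almost_subtractive (\bigcup_l W l)).
Proof.
split=> [V Vmon VU|L W [l0] Wchain Was].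
  split=> // u u' z z' Vu Vu'.
  by apply: hU.2; apply: VU.
split.
  apply/submonoidE; split.
    (* Nonemptiness of the chain enters here: an empty union would miss [0]. *)
    by exists l0 => //; have [/submonoidE[]] := Was l0.
  move=> x y [l _ Wx] [m _ Wy].
  have [k [lk mk]] := set_chain_directed l m Wchain.
  have [/submonoidE[_ WD] _] := Was k.
  by exists k => //; apply: WD; [apply: lk|apply: mk].
move=> u u' z z' [l _ Wu] [m _ Wu'].
have [k [lk mk]] := set_chain_directed l m Wchain.
by apply: (Was k).2; [apply: lk|apply: mk].
Qed.
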